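(* Any randomized non-adaptive algorithm that, using only pair queries (subset queries on sets $S$ with $|S|=2$), recovers every hidden $3$-clustering of an $n$-point universe with probability at least $2/3$ must make $\Omega(n^2)$ queries.
   Context: Let $U$ be a set of $n$ points. A $3$-clustering is a hidden partition $U=C_1\sqcup C_2\sqcup C_3$ into pairwise disjoint (possibly empty) sets. A subset query on $S\subseteq U$ returns $\mathsf{count}(S)=|\{i: C_i\cap S\neq\emptyset\}|$. An algorithm is non-adaptive if its (possibly random) set of queries is fixed before any answer is received. *)

(* Defs.v *)
From HB Require Import structures.
From mathcomp Require Import all_boot all_order all_algebra perm.

Set Implicit Arguments.
Unset Strict Implicit.
Unset Printing Implicit Defensive.

Section Clustering.
Variable U : finType.

Definition is_3clustering (C : {ffun 'I_3 -> {set U}}) : Prop :=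
  (forall i j, i != j -> [disjoint C i & C j]) /\ \bigcup_i C i = [set: U].

Definition cluster_count (C : {ffun 'I_3 -> {set U}}) (S : {set U}) : nat :=
  #|[set i | C i :&: S != set0]|.

(* The indices of the parts carry no information ([cluster_count] is invariant under
   relabelling), so a hidden partition is recovered up to a permutation of
   its three labels. *)
Definition same_clustering (C D : {ffun 'I_3 -> {set U}}) : Prop :=
  exists s : 'S_3, forall i, D i = C (s i).

(* A deterministic non-adaptive algorithm: a fixed set of queries and a rule
   computing the output from the answers, encoded as a partial function
   defined exactly on the queried sets. *)
Record nonadaptive_alg := NonadaptiveAlg {
  queries : {set {set U}};
  decoder : {ffun {set U} -> option nat} -> {ffun 'I_3 -> {set U}}
}.

Definition answers (A : nonadaptive_alg) (C : {ffun 'I_3 -> {set U}}) :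
    {ffun {set U} -> option nat} :=
  [ffun S => if S \in queries A then Some (cluster_count C S) else None].

Definition recovers (A : nonadaptive_alg) (C : {ffun 'I_3 -> {set U}}) : Prop :=
  same_clustering C (decoder A (answers A C)).

Definition pair_queries_only (A : nonadaptive_alg) : Prop :=
  forall S, S \in queries A -> #|S| = 2.

End Clustering.

From mathcomp Require Import all_classical all_reals all_analysis.

Local Open Scope classical_set_scope.
Local Open Scope ring_scope.

(* A randomized non-adaptive algorithm is a random deterministic one, [A w]
   being the algorithm run on the random seed [w]; this covers randomness used
   after the answers are received, which may be drawn in advance. *)
Definition random_alg (d : measure_display) (Omega : measurableType d)
    (U : finType) (A : Omega -> nonadaptive_alg U) : Prop :=
  (forall Q, measurable [set w | queries (A w) = Q]) /\
  (forall a D, measurable [set w | decoder (A w) a = D]).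

Definition recovery_prob (R : realType) (d : measure_display)
    (Omega : measurableType d) (P : probability Omega R) (U : finType)
    (A : Omega -> nonadaptive_alg U) (C : {ffun 'I_3 -> {set U}}) : \bar R :=
  P [set w | recovers (A w) C].

(* Main.v *)
Require Import Defs.
From HB Require Import structures.
From mathcomp Require Import all_boot all_order all_algebra.
From mathcomp Require Import perm lra.
From mathcomp Require Import all_classical all_reals all_analysis.
From mathcomp Require Import measurable_realfun.

(** Two clusterings that agree except on whether [x] and [y] lie together,
    namely [{x}, {y}, rest] and [{x, y}, rest, empty], give the same answer to
    every pair query other than [{x, y}].  An algorithm that recovers each of
    them with probability 2/3 recovers both with probability at least 1/3, and
    must then have queried [{x, y}].  Summing over all pairs, the expected
    number of queries is at least [n (n - 1) / 6]. *)

Set Implicit Arguments.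
Unset Strict Implicit.
Unset Printing Implicit Defensive.

Import Order.TTheory GRing.Theory Num.Theory.

Local Open Scope ring_scope.

Section Labelings.
Variable U : finType.
Implicit Types (f g : U -> 'I_3) (A : nonadaptive_alg U).

Definition clustering_of f : {ffun 'I_3 -> {set U}} :=
  [ffun i => [set u | f u == i]].

Lemma clustering_ofP f : is_3clustering (clustering_of f).
Proof.
split=> [i j nij|].
  rewrite -setI_eq0; apply/eqP/setP => u; rewrite !ffunE !inE.
  by case: eqP => // ->; rewrite (negbTE nij).
apply/setP => u; rewrite inE; apply/bigcupP; exists (f u) => //.
by rewrite ffunE inE.
Qed.

Lemma cluster_count_of f (S : {set U}) :
  cluster_count (clustering_of f) S = #|f @: S|.
Proof.
congr #|pred_of_set _|; apply/setP => i; rewrite inE ffunE.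
apply/set0Pn/imsetP => [[u]|[u uS ->]].
  by rewrite !inE => /andP[/eqP <- uS]; exists u.
by exists u; rewrite !inE eqxx.
Qed.

(** A pair query returns 1 or 2 according to whether its two points share a label, so only this
    equality pattern reaches the decoder. *)
Lemma eq_answers A f g : pair_queries_only A ->
    (forall a b, [set a; b] \in queries A -> (f a == f b) = (g a == g b)) ->
  answers A (clustering_of f) = answers A (clustering_of g).
Proof.
move=> A2 fg; apply/ffunP => S; rewrite !ffunE.
case: ifP => // SA; congr (Some _).
have /eqP/cards2P[a [b [_ defS]]] := A2 S SA.
by rewrite !cluster_count_of defS !imsetU1 !imset_set1 !cards2 fg // -defS.
Qed.

(** Both labelings are relabelings of [D], so they differ by a permutation of the labels, which is
    injective. *)
Lemma same_clustering_of f g D :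
    same_clustering (clustering_of f) D -> same_clustering (clustering_of g) D ->
  forall a b, (f a == f b) = (g a == g b).
Proof.
move=> [s Ds] [t Dt] a b.
have gE u : g u = t (s^-1%g (f u)).
  have : u \in D (s^-1%g (f u)) by rewrite Ds permKV ffunE inE.
  by rewrite Dt ffunE inE => /eqP.
by rewrite !gE !(inj_eq perm_inj).
Qed.

Definition split_label (x y : U) : U -> 'I_3 :=
  fun u => if u == x then inord 0 else if u == y then inord 1 else inord 2.

Definition merge_label (x y : U) : U -> 'I_3 :=
  fun u => if u \in [set x; y] then inord 0 else inord 2.

(** Without this query the answers coincide, so a single output would have to match both
    clusterings, although only one of them separates [x] from [y]. *)
Lemma split_merge_query A x y : pair_queries_only A -> x != y ->
    recovers A (clustering_of (split_label x y)) ->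
    recovers A (clustering_of (merge_label x y)) ->
  [set x; y] \in queries A.
Proof.
move=> A2 nxy rs rm; apply/negPn/negP => nA.
have eqA : answers A (clustering_of (split_label x y)) =
           answers A (clustering_of (merge_label x y)).
  apply: eq_answers => // a b abA.
  have : [set a; b] != [set x; y] by apply: contraNneq nA => <-.
  rewrite /split_label /merge_label !inE.
  (* If exactly one of [a], [b] is [x], the other is not [y], and both labelings separate the two.
     If neither is [x], both labelings only tell [y] from the rest. *)
  have [->|_] := eqVneq a x; have [->|_] := eqVneq b x => //=.
  - by have [->|] := eqVneq b y; rewrite ?eqxx.
  - by have [->|] := eqVneq a y; rewrite ?[[set y; x]]finset.setUC ?eqxx.
  - by case: ifP; case: ifP; rewrite -!val_eqE /= ?inordK.
rewrite /recovers eqA in rs; have := same_clustering_of rs rm x y.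
rewrite /split_label /merge_label !inE !eqxx orbT [y == x]eq_sym (negbTE nxy) /=.
by rewrite -!val_eqE /= !inordK.
Qed.

End Labelings.

Section Probability.
Variables (R : realType) (d : measure_display) (Omega : measurableType d).
Variable P : probability Omega R.

Lemma finite_measurable_preimage (T : finType) (X : Omega -> T) (B : {pred T}) :
    (forall t, measurable [set w | X w = t]%classic) ->
  measurable [set w | X w \in B]%classic.
Proof.
move=> mX.
rewrite (_ : mkset _ = \big[setU/set0]_(t in B) [set w | X w = t]%classic).
  by apply: bigsetU_measurable => t _; exact: mX.
rewrite -bigcup_pred; apply/seteqP; split=> w /=.
  by move=> BX; exists (X w).
by move=> [t /= Bt ->].
Qed.

(** Inclusion-exclusion, with the probability of the union bounded by 1. *)
Lemma probability_setI_ge (E F : set Omega) : measurable E -> measurable F ->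
  (P E + P F - 1 <= P (E `&` F)%classic)%E.
Proof.
move=> mE mF; have := probability_le1 P (measurableU _ _ mE mF).
have PEF : P (E `&` F)%classic \is a fin_num.
  by rewrite fin_num_measure //; exact: measurableI.
rewrite measureUfinl // ?ltey_eq ?fin_num_measure //.
by rewrite leeBlDr // leeBlDl.
Qed.

(** Linearity of expectation: the sum is the expected cardinality of [X]. *)
Lemma sum_probability_mem_le (T : finType) (X : Omega -> {set T}) (q : nat) :
    (forall B, measurable [set w | X w = B]%classic) ->
    (forall w, (#|X w| <= q)%N) ->
  (\sum_(t : T) P [set w | t \in X w]%classic <= q%:R%:E)%E.
Proof.
move=> mX Xq.
have mE t : measurable [set w | t \in X w]%classic.
  exact: finite_measurable_preimage [pred B : {set T} | t \in B] mX.
have mI t : measurable_fun setT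
    (EFin \o (\1_[set w | t \in X w]%classic : Omega -> R)).
  by apply/measurable_EFinP; exact: measurable_indic.
rewrite (eq_bigr (fun t => \int[P]_w (\1_[set w | t \in X w]%classic w)%:E)%E); last first.
  by move=> t _; rewrite integral_indic // setIT.
rewrite -ge0_integral_sum //.
apply: (@le_trans _ _ (\int[P]_w (cst q%:R%:E w))%E).
  apply: ge0_le_integral => //.
  - by move=> w _; apply: sume_ge0 => t _; rewrite lee_fin.
  - exact: emeasurable_sum.
  - move=> w _; rewrite sumEFin lee_fin /cst.
    rewrite (eq_bigr (fun t => (t \in X w)%:R)) => [|t _]; last first.
      by rewrite indicE mem_setE.
    by rewrite -natr_sum ler_nat -big_mkcond sum1_card Xq.
by rewrite integral_cst // [X in (_ * X)%E]probability_setT mule1.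
Qed.

(** Recovery depends only on the query set and the output, a pair with finitely many values, whereas
    decoders have an infinite domain. *)
Lemma measurable_recovers (U : finType) (A : Omega -> nonadaptive_alg U) C :
  random_alg A -> measurable [set w | recovers (A w) C]%classic.
Proof.
move=> [mQ mD].
pose X w := (queries (A w), decoder (A w) (answers (A w) C)).
pose B := [pred p : {set {set U}} * {ffun 'I_3 -> {set U}}
             | `[< same_clustering C p.2 >]].
rewrite (_ : mkset _ = [set w | X w \in B]%classic); last first.
  by apply/seteqP; split=> w /= /asboolP.
apply: finite_measurable_preimage => -[Q D].
(* Once the query set is fixed to [Q], the answers are the constant [a Q], and the decoder is
   evaluated at a fixed argument. *)
pose a (Q' : {set {set U}}) : {ffun {set U} -> option nat} :=
  [ffun S => if S \in Q' then Some (cluster_count C S) else None].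
rewrite (_ : mkset _ = [set w | queries (A w) = Q] `&`
                       [set w | decoder (A w) (a Q) = D])%classic.
  exact: measurableI.
apply/seteqP; split=> w /=.
  by move=> [<- <-]; split.
by move=> [QE <-]; rewrite /X /answers QE.
Qed.

Lemma query_probability_ge (U : finType) (A : Omega -> nonadaptive_alg U)
    (x y : U) :
    random_alg A -> (forall w, pair_queries_only (A w)) ->
    (forall C, is_3clustering C ->
       ((2 / 3 : R)%:E <= recovery_prob P A C)%E) ->
    x != y ->
  ((3^-1 : R)%:E <= P [set w | [set x; y]%SET \in queries (A w)]%classic)%E.
Proof.
move=> rA A2 A23 nxy.
have rs := A23 _ (clustering_ofP (split_label x y)).
have rm := A23 _ (clustering_ofP (merge_label x y)).
pose rec f : set Omega := [set w | recovers (A w) (clustering_of f)]%classic.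
have mrec f : measurable (rec f) by exact: measurable_recovers.
have mS : measurable [set w | [set x; y]%SET \in queries (A w)]%classic.
  exact: finite_measurable_preimage
    [pred Q : {set {set U}} | [set x; y]%SET \in Q] rA.1.
apply: (@le_trans _ _
    (P (rec (split_label x y) `&` rec (merge_label x y))%classic)); last first.
  apply: le_measure; rewrite ?inE //; first exact: measurableI.
  by move=> w [? ?]; exact: split_merge_query.
apply: le_trans (probability_setI_ge (mrec _) (mrec _)).
apply: (@le_trans _ _ ((2 / 3 : R)%:E + (2 / 3 : R)%:E - 1)%E).
  by rewrite -!EFinD lee_fin; lra.
by rewrite leeD2r // leeD.
Qed.

End Probability.

Theorem theorem3p7 (R : realType) :
  exists (c : R) (n0 : nat), 0 < c /\
    forall (n : nat) (U : finType) (d : measure_display)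
      (Omega : measurableType d) (P : probability Omega R)
      (A : Omega -> nonadaptive_alg U) (q : nat),
      (n0 <= n)%N -> #|U| = n ->
      random_alg A ->
      (forall w, pair_queries_only (A w)) ->
      (forall w, (#|queries (A w)| <= q)%N) ->
      (forall C, is_3clustering C ->
         ((2 / 3 : R)%:E <= recovery_prob P A C)%E) ->
      c * n%:R ^+ 2 <= q%:R.
Proof.
(* For n >= 2 one has n - 1 >= n / 2, hence n (n - 1) / 6 >= n^2 / 12. *)
exists 12^-1, 2; split; first lra.
move=> n U d Omega P A q n2 Un rA A2 Aq A23.
have : 3^-1 *+ 'C(n, 2) <= q%:R :> R.
  rewrite -lee_fin; apply: le_trans (sum_probability_mem_le P rA.1 Aq).
  rewrite -Un -card_draws cardsE -sumr_const big_mkcond -sumEFin.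
  (* The sum runs over all subsets of [U]; those not of size 2 are bounded below by 0. *)
  apply: lee_sum => S _.
  case: ifPn => // /cards2P[x [y [nxy ->]]]; exact: query_probability_ge.
have : (2 * 'C(n, 2))%:R = n%:R * (n%:R - 1) :> R.
  by rewrite -mul_bin_diag bin1 natrM -subn1 natrB // (leq_trans _ n2).
have : 2 <= n%:R :> R by rewrite ler_nat.
rewrite natrM -mulr_natr; nra.
Qed.
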